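(* Let $f:\mathbb{R}^n\to\mathbb{R}$ be convex and differentiable, and assume that there are constants $L_1,\dots,L_n>0$ such that for each $i=1,\dots,n$, $$|\nabla_i f(x)-\nabla_i f(x+he_i)|\le L_i|h|\qquad\text{for all }x\in\mathbb{R}^n,\ h\in\mathbb{R}.$$ Let $\psi$ be a convex, extended-valued, proper and closed function on $\mathbb{R}^n$ that is separable, that is, $\psi(x)=\sum_{i=1}^n\psi_i(x_i)$, where each $\psi_i$ is a convex, extended-valued, possibly nondifferentiable function on $\mathbb{R}$. Put $F=f+\psi$, and assume that the solution set $\Omega=\arg\min_x F(x)$ is nonempty, with $F^*=\min_x F(x)$. Let $\bar L_1,\dots,\bar L_n$ satisfy $\bar L_i\ge L_i$ for all $i$, and let $p_1,\dots,p_n$ satisfy $\sum_{i=1}^n p_i=1$ and $p_i\ge p_{\min}$ for all $i$, for some constant $p_{\min}>0$. Suppose that, from an initial point $x_0\in\mathbb{R}^n$, proximal coordinate descent defines iterates by $$x_{k+1}=x_k+d^k_{i_k}e_{i_k},\qquad d^k_{i_k}=\arg\min_{d\in\mathbb{R}}\ \nabla_{i_k}f(x_k)\,d+\frac{\bar L_{i_k}}{2}d^2+\psi_{i_k}\left((x_k)_{i_k}+d\right),\qquad k=0,1,2,\dots,$$ where $i_0,i_1,i_2,\dots$ are independent and identically distributed random indices in $\{1,\dots,n\}$ with $\Pr(i_k=i)=p_i$. Then $\mathbb{E}_{i_0,\dots,i_{k-1}}[F(x_k)]$ converges to $F^*$ at an asymptotic rate of $o(1/k)$, that is, $\lim_{k\to\infty}k\left(\mathbb{E}_{i_0,\dots,i_{k-1}}[F(x_k)]-F^*\right)=0$.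 Moreover, given any $\bar x\in\Omega$, setting $$r_k^2=\sum_{i=1}^n\frac{\bar L_i}{p_i}\left((x_k-\bar x)_i\right)^2,$$ the sequence $\mathbb{E}_{i_0,\dots,i_{k-1}}[r_k^2]$, $k=0,1,2,\dots$, is bounded.
   Context: Here $e_i$ is the $i$th standard unit vector of $\mathbb{R}^n$, $\nabla_i f(x)$ is the $i$th coordinate of the gradient $\nabla f(x)$, and $(x)_i$ or $x_i$ denotes the $i$th coordinate of a vector $x$. $\mathbb{E}_{i_0,\dots,i_{k-1}}$ denotes expectation over the random indices $i_0,\dots,i_{k-1}$.
   Formalization: The o(1/k) claim is stated for starting points with F(x_0) finite; otherwise, for n ≥ 2, some coordinate stays outside the domain with positive probability at every step, so the expectation of F(x_k) is infinite for all k. Boundedness of E[r_k^2] is kept for every x_0. *)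

(* Defs.v *)
From HB Require Import structures.
From mathcomp Require Import all_boot all_order all_algebra.
From mathcomp Require Import all_classical all_reals all_analysis.

Set Implicit Arguments.
Unset Strict Implicit.
Unset Printing Implicit Defensive.

Import Order.TTheory GRing.Theory Num.Theory.
Import numFieldNormedType.Exports.

Local Open Scope classical_set_scope.
Local Open Scope ring_scope.

(* [measurableType] requires an inhabited carrier, whence ['I_n.+1]. *)
HB.instance Definition _ (n : nat) := isPointed.Build 'I_n.+1 ord0.
HB.instance Definition _ (n : nat) :=
  @isMeasurable.Build default_measure_display 'I_n.+1 discrete_measurable
    discrete_measurable0 discrete_measurableC discrete_measurableU.

Section convex_analysis.
Context {R : realType} {V : normedModType R}.
Implicit Types g : V -> \bar R.

Definition epigraph g : set (V * R^o) := [set z | (g z.1 <= z.2%:E)%E].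

(* Convexity of an extended-valued function is convexity of its epigraph, so
   that no convention on [+oo - oo] is involved. *)
Definition convex_efun g : Prop := convex_set (epigraph g).

Definition closed_efun g : Prop := closed (epigraph g).

Definition proper_efun g : Prop :=
  (exists x, (g x < +oo)%E) /\ (forall x, (-oo < g x)%E).

End convex_analysis.

Definition argmin {R : realType} {T : Type} (g : T -> \bar R) : set T :=
  [set x | forall y, (g x <= g y)%E].

(* [f] being differentiable, its partial derivatives are the coordinates of
   the vector representing ['d f x]. *)
Definition gradient {R : realType} {n : nat} (f : 'rV[R]_n -> R)
    (x : 'rV[R]_n) : 'rV[R]_n :=
  \row_i 'D_(delta_mx ord0 i) f x.

Definition mutually_independent {d d' : measure_display}
    {T : measurableType d} {T' : measurableType d'} {R : realType}
    (P : probability T R) (X : nat -> {RV P >-> T'}) : Prop :=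
  forall (s : seq nat) (A : nat -> set T'),
    uniq s -> (forall k, measurable (A k)) ->
    P (\bigcap_(k in [set` s]) X k @^-1` A k) =
      (\prod_(k <- s) P (X k @^-1` A k))%E.

(* Main.v *)
Require Import Defs.
From mathcomp Require Import all_boot all_order all_algebra.
From mathcomp Require Import all_classical all_reals all_analysis.
From mathcomp Require Import measurable_realfun ring lra.

Set Implicit Arguments.
Unset Strict Implicit.
Unset Printing Implicit Defensive.

Import Order.TTheory GRing.Theory Num.Theory.
Import numFieldNormedType.Exports.

Local Open Scope classical_set_scope.
Local Open Scope ring_scope.

(* Let r^2 be the weighted squared distance to a minimizer xbar.  The optimality
   condition of the proximal step and coordinate descent give, after averaging
   over the index, E[r_+^2] <= r^2 - 2 gap + (2 / pmin) (gap - E[gap_+]), where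
   gap = F - F*.  Hence r^2 + (2 / pmin) gap is a supermartingale whose decrease
   bounds the sum of the expected gaps; the gaps being nonincreasing, they are
   o(1/k).
   When F(x_0) is infinite, each psi_i is replaced off its domain by its
   supporting line at xbar.  The first update of a coordinate starting off the
   domain may then increase gap, but by at most (pmin / 2) gap plus a constant,
   because (grad_i f(x) - grad_i f(xbar))^2 <= 2 L_i gap.  Half of the decrease
   absorbs the first part, and the constant is paid for by a penalty carried
   by each coordinate not updated yet. *)

(** * One-dimensional proximal steps and coordinatewise smoothness *)

(** Stands in for the limit [l -> 0] once a minimality inequality along a segment has been divided
    by [l]. *)
Lemma ge0_of_ge0_perturb (R : realType) (a b : R) :
  (forall l, 0 < l -> l <= 1 -> 0 <= a + l * b) -> 0 <= a.
Proof.
move=> ab; rewrite leNgt; apply/negP => a0.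
have b0 := normr_ge0 b.
have den : 0 < 2 * (`|b| - a) by lra.
(* With this choice [a + l * b] is at most [a / 2 + l * a], which is negative. *)
pose l := - a / (2 * (`|b| - a)).
have lE : l * (2 * (`|b| - a)) = - a by rewrite /l divfK// gt_eqF.
have l0 : 0 < l by rewrite divr_gt0 ?oppr_gt0.
have l1 : l <= 1 by rewrite ler_pdivrMr// mul1r; lra.
have := ab _ l0 l1.
have : l * b <= l * `|b| by rewrite ler_wpM2l ?ler_norm// ltW.
have : l * a < 0 by rewrite pmulr_rlt0.
nra.
Qed.

(** The terms between N and k are at least [u k], so (k - N) [u k] is bounded by a tail of a
    convergent series. For k at least 2 N this is at least half of k [u k]. *)
Lemma nonincreasing_summable_o (R : realType) (u : nat -> R) (M : R) :
  (forall k, 0 <= u k) -> (forall k, u k.+1 <= u k) ->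
  (forall k, \sum_(j < k) u j <= M) ->
  (k%:R * u k) @[k --> \oo] --> 0.
Proof.
move=> u0 uS uM.
pose s := series u.
have sE k : s k = \sum_(j < k) u j by rewrite /s /series/= big_mkord.
have scvg : cvgn s.
  apply: nondecreasing_is_cvgn.
    by apply/nondecreasing_seqP => k; rewrite !sE big_ord_recr/= lerDl.
  by exists M => _ [k _ <-]; rewrite sE.
have sle k : s k <= limn s.
  apply: nondecreasing_cvgn_le => //.
  by apply/nondecreasing_seqP => m; rewrite !sE big_ord_recr/= lerDl.
have gap m j : j%:R * u (m + j)%N <= s (m + j)%N - s m.
  elim: j => [|j ih]; first by rewrite mul0r addn0 subrr.
  rewrite addnS [s (m + j).+1]sE big_ord_recr/= -sE -natr1 mulrDl mul1r.
  have h := uS (m + j)%N.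
  have : j%:R * u (m + j).+1 <= j%:R * u (m + j)%N by rewrite ler_wpM2l.
  by lra.
apply/cvgrPdist_le => /= e e0.
have e2 : 0 < e / 2 by lra.
move/cvgrPdist_le : (scvg) => /(_ _ e2) [N _ /(_ N (leqnn N))] /= sN.
near=> k.
have Nk : (N.*2 <= k)%N by near: k; exists N.*2.
have Nk' : (N <= k)%N by apply: leq_trans Nk; rewrite -addnn leq_addr.
rewrite sub0r normrN ger0_norm ?mulr_ge0//.
have := gap N (k - N)%N; rewrite subnKC// natrB// => h1.
have h2 : N%:R *+ 2 <= k%:R :> R by rewrite -mulrnA ler_nat muln2.
have h3 := sle k.
have h4 : limn s - s N <= e / 2 by apply: le_trans sN; rewrite ler_norm.
have h5 : (k%:R - N%:R *+ 2) * u k >= 0 by rewrite mulr_ge0 ?subr_ge0.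
by lra.
Unshelve. all: by end_near.
Qed.

Lemma convex_efun_le (R : realType) (phi : R -> \bar R) (s t a b l : R) :
  convex_efun (V := R^o) phi -> (phi s <= a%:E)%E -> (phi t <= b%:E)%E ->
  0 <= l <= 1 ->
  (phi (l * s + (1 - l) * t)%R <= (l * a + (1 - l) * b)%:E)%E.
Proof.
move=> cphi sa tb /andP[l0 l1].
have := cphi (s, a) (t, b) (Itv01 l0 l1).
by rewrite !inE; apply.
Qed.

Section prox.
Context {R : realType}.
Variables (phi : R -> \bar R) (b c y d : R).
Hypothesis phi_gtNy : forall t, (-oo < phi t)%E.
Hypothesis dmin :
  argmin (fun t => ((b * t + c / 2 * t ^+ 2)%:E + phi (y + t)%R)%E) d.

Lemma prox_fin z : (phi z < +oo)%E -> (phi (y + d)%R < +oo)%E.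
Proof.
move=> z_fin; have := dmin (z - y); rewrite subrKC.
have zf : phi z \is a fin_num by rewrite fin_numElt phi_gtNy.
rewrite -(fineK zf) -EFinD.
by case: (phi (y + d)) => [r| |] //=; rewrite ltry.
Qed.

Lemma prox_min z : (phi z < +oo)%E ->
  b * d + c / 2 * d ^+ 2 + fine (phi (y + d)) <=
  b * (z - y) + c / 2 * (z - y) ^+ 2 + fine (phi z).
Proof.
move=> z_fin; have := dmin (z - y); rewrite subrKC.
rewrite -{1}[phi z]fineK ?fin_numElt ?phi_gtNy//.
by rewrite -{1}[phi (y + d)]fineK ?fin_numElt ?phi_gtNy ?(prox_fin z_fin)//.
Qed.

(** Says that [- (b + c * d)] is a subgradient of [phi] at [y + d]. Compare [d] with the point a
    fraction [l] of the way from [y + d] to [z]: the quadratic leaves an error of order [l ^+ 2],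
    negligible after division by [l]. *)
Lemma prox_three_point z : convex_efun (V := R^o) phi -> (phi z < +oo)%E ->
  fine (phi (y + d)) <= fine (phi z) + (b + c * d) * (z - (y + d)).
Proof.
move=> cphi z_fin; have d_fin := prox_fin z_fin.
rewrite -subr_ge0.
apply: (@ge0_of_ge0_perturb _ _ (c / 2 * (z - (y + d)) ^+ 2)) => l l0 l1.
have zE : phi z = (fine (phi z))%:E by rewrite fineK ?fin_numElt ?phi_gtNy.
have dE : phi (y + d) = (fine (phi (y + d)))%:E.
  by rewrite fineK ?fin_numElt ?phi_gtNy.
have zl : (phi z <= (fine (phi z))%:E)%E by rewrite -zE.
have dl : (phi (y + d)%R <= (fine (phi (y + d)))%:E)%E by rewrite -dE.
have l01 : 0 <= l <= 1 by rewrite (ltW l0).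
have conv := convex_efun_le cphi zl dl l01.
set w := l * z + _ in conv.
have w_fin : (phi w < +oo)%E by apply: le_lt_trans conv _; rewrite ltry.
have wle : fine (phi w) <= l * fine (phi z) + (1 - l) * fine (phi (y + d)).
  by move: conv; rewrite -{1}[phi w]fineK ?lee_fin// fin_numElt phi_gtNy.
have m := prox_min w_fin.
rewrite -(pmulr_rge0 _ l0).
have wE : w - y = d + l * (z - (y + d)) by rewrite /w; ring.
rewrite wE in m.
nra.
Qed.

End prox.

(** The subgradient inequality of each minimizer, taken at the other, sums to
    [c * (d - d') ^+ 2 <= 0]. *)
Lemma prox_unique (R : realType) (phi : R -> \bar R) (b c y : R) d d' z :
  (forall t, (-oo < phi t)%E) -> convex_efun (V := R^o) phi ->
  (phi z < +oo)%E -> 0 < c ->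
  let h t := ((b * t + c / 2 * t ^+ 2)%:E + phi (y + t)%R)%E in
  argmin h d -> argmin h d' -> d = d'.
Proof.
move=> Ny cphi z_fin c0 h dm dm'.
have h1 := prox_three_point Ny dm cphi (prox_fin Ny dm' z_fin).
have h2 := prox_three_point Ny dm' cphi (prox_fin Ny dm z_fin).
apply/eqP; rewrite -subr_eq0 -sqrf_eq0 eq_le sqr_ge0 andbT.
rewrite -(pmulr_rle0 _ c0); by lra.
Qed.

(** * Convexity and coordinatewise smoothness *)

Section gradient.
Context {R : realType} {n : nat}.
Variable f : 'rV[R]_n -> R.
Hypothesis f_diff : forall x, differentiable f x.

Lemma derive_gradient x v : 'D_v f x = \sum_i gradient f x ord0 i * v ord0 i.
Proof.
rewrite deriveE// [v in LHS]row_sum_delta linear_sum; apply: eq_bigr => i _.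
by rewrite linearZ /= mxE deriveE// mulrC.
Qed.

Lemma is_derive_line x v (s : R) :
  is_derive s 1 (fun s : R => f (x + s *: v)) ('D_v f (x + s *: v)).
Proof.
have /derivableP := @diff_derivable _ _ _ f _ v (f_diff (x + s *: v)).
have E : (fun h : R => h^-1 *: ((f \o shift (x + s *: v)) (h *: v) -
    f (x + s *: v))) = (fun h : R => h^-1 *:
    (((fun s : R => f (x + s *: v)) \o shift s) (h *: 1) - f (x + s *: v))).
  apply/funext => h /=; congr (_ *: (f _ - _)).
  by rewrite [h *: 1]mulr1 scalerDl addrCA.
move=> -[+ _]; rewrite /derivable E => dv.
by split; rewrite ?/derivable// /derive E.
Qed.

Lemma derive_delta_gradient x h i :
  'D_(h *: delta_mx ord0 i) f x = h * gradient f x ord0 i.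
Proof. by rewrite deriveE// linearZ /= mxE deriveE. Qed.

(** By convexity the difference quotients of [f] from [x] towards [y] are at most [f y - f x] for
    steps in (0, 1]; the bound passes to the right limit at 0. *)
Lemma convex_gradient_le x y : convex_function [set: 'rV[R]_n] f ->
  f x + \sum_i gradient f x ord0 i * (y - x) ord0 i <= f y.
Proof.
move=> cf; rewrite -derive_gradient -lerBrDl.
have [+ D] := is_derive_line x (y - x) 0.
rewrite scale0r addr0 in D; rewrite -D => /cvg_dnbhs_at_right/cvgr_to_le; apply.
near=> h.
have h0 : 0 < h by near: h; exact: nbhs_right_gt.
have h1 : h <= 1 by near: h; exact: nbhs_right_le.
have le_conv : f (h *: y + (1 - h) *: x) <= h * f y + (1 - h) * f x.
  by have := cf (Itv01 (ltW h0) h1) y x; rewrite !inE; apply.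
have yx : h *: y + (1 - h) *: x = x + h *: (y - x).
  by rewrite scalerBl scale1r scalerBr addrCA addrA.
rewrite yx in le_conv.
rewrite /= scale0r !addr0 [h *: 1]mulr1 ler_pdivrMl//.
by rewrite lerBlDr; apply: le_trans le_conv _; lra.
Unshelve. all: by end_near.
Qed.

Lemma coordinate_descent x i (L h : R) :
  (forall h, `|gradient f x ord0 i
      - gradient f (x + h *: delta_mx ord0 i) ord0 i| <= L * `|h|) ->
  f (x + h *: delta_mx ord0 i) <=
  f x + gradient f x ord0 i * h + L / 2 * h ^+ 2.
Proof.
move=> f_smooth; pose v := h *: delta_mx ord0 i : 'rV[R]_n.
pose a := h * gradient f x ord0 i; pose b := L / 2 * h ^+ 2.
(* [q] subtracts the quadratic model from [f] along the segment. Smoothness makes its derivative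
   nonpositive for positive [s], and the mean value theorem then gives [q 1 <= q 0]. *)
pose q : R -> R := (fun s => f (x + s *: v)) - (a \*: id + b \*: id ^+ 2).
pose dq (s : R) := h * gradient f (x + s *: v) ord0 i - (a + 2 * b * s).
have q_diff (s : R) : is_derive s 1 q (dq s).
  have fl := is_derive_line x v s; rewrite derive_delta_gradient in fl.
  apply: is_derive_eq; rewrite /dq /=.
  by rewrite /GRing.scale /=; ring.
have qc : {within `[0, 1], continuous q}.
  by apply: derivable_within_continuous => s _; exact: ex_derive.
have [s /[!in_itv]/= /andP[s0 _]] := MVT ltr01 (fun s _ => q_diff s) qc.
rewrite subr0 mulr1.
have qE (t : R) : q t = f (x + t *: v) - (a * t + b * t ^+ 2) by [].
rewrite !qE scale1r scale0r addr0 /dq.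
have bnd : h * gradient f (x + s *: v) ord0 i - a <= 2 * b * s.
  rewrite /a -mulrBr (le_trans (ler_norm _))// normrM distrC.
  have := f_smooth (s * h); rewrite -scalerA normrM (gtr0_norm s0) => le_s.
  apply: (le_trans (ler_wpM2l (normr_ge0 h) le_s)).
  rewrite (_ : `|h| * _ = L * `|h| ^+ 2 * s); last by ring.
  by rewrite real_normK ?num_real// /b; lra.
by move: bnd; rewrite -/v /a/b; lra.
Qed.

(** Move [x] by [- D / L] along coordinate [i]. There the tangent plane at [y] bounds [f] from below
    and [coordinate_descent] bounds it from above; together they bound [D ^+ 2 / (2 * L)]. *)
Lemma gradient_diff_sqr_le x y i (L : R) : 0 < L ->
  convex_function [set: 'rV[R]_n] f ->
  (forall h, `|gradient f x ord0 i
      - gradient f (x + h *: delta_mx ord0 i) ord0 i| <= L * `|h|) ->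
  (gradient f x ord0 i - gradient f y ord0 i) ^+ 2 <=
  2 * L * (f x - f y - \sum_j gradient f y ord0 j * (x - y) ord0 j).
Proof.
move=> L0 cf f_smooth.
set D := gradient f x ord0 i - gradient f y ord0 i.
pose s := D / L; have sL : s * L = D by rewrite /s divfK ?gt_eqF.
have low := convex_gradient_le y (x + - s *: delta_mx ord0 i) cf.
have up := coordinate_descent (- s) f_smooth.
have sumE : \sum_j gradient f y ord0 j
      * (x + - s *: delta_mx ord0 i - y) ord0 j =
    \sum_j gradient f y ord0 j * (x - y) ord0 j - s * gradient f y ord0 i.
  rewrite -!derive_gradient addrAC !deriveE// linearD/=; congr (_ + _).
  by rewrite linearZ/= mxE deriveE// /GRing.scale/= mulNr.
rewrite sumE in low.
have key : s * D - L / 2 * s ^+ 2 <=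
    f x - f y - \sum_j gradient f y ord0 j * (x - y) ord0 j.
  by rewrite /D; lra.
rewrite -(ler_pM2l (x := 2 * L)) in key; last by rewrite mulr_gt0.
apply: le_trans key; rewrite -sL.
by rewrite (_ : 2 * L * _ = (s * L) ^+ 2)//; lra.
Qed.

End gradient.

(** * Expectations along the random run *)

Section mean_after.
Context {R : realType} {n : nat} {X : Type}.
Variables (p : 'I_n -> R) (step : X -> 'I_n -> X).
Implicit Types (H G : X -> R) (I : X -> Prop).

(** Iterated transition operator of the chain, expanded on the first step; [integral_run] identifies
    it with an expectation. *)
Fixpoint mean_after (k : nat) H (y : X) : R :=
  if k is k'.+1 then \sum_i p i * mean_after k' H (step y i) else H y.

Hypothesis p_ge0 : forall i, 0 <= p i.

(** The invariant [I] confines the comparison to points that the chain visits, which are those where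
    proximal minimizers will be known to exist. *)
Lemma mean_after_le H G I k y : (forall y i, I y -> I (step y i)) ->
  (forall y, I y -> H y <= G y) -> I y -> mean_after k H y <= mean_after k G y.
Proof.
move=> Istep HG; elim: k y => [|k ih] y Iy /=; first exact: HG.
by apply: ler_sum => i _; rewrite ler_wpM2l// ih//; exact: Istep.
Qed.

Lemma mean_after_ge0 H I k y : (forall y i, I y -> I (step y i)) ->
  (forall y, I y -> 0 <= H y) -> I y -> 0 <= mean_after k H y.
Proof.
move=> Istep H0; elim: k y => [|k ih] y Iy /=; first exact: H0.
by apply: sumr_ge0 => i _; rewrite mulr_ge0// ih//; exact: Istep.
Qed.

Lemma mean_after_noninc H I k y : \sum_i p i = 1 ->
  (forall y i, I y -> I (step y i)) ->
  (forall y i, I y -> H (step y i) <= H y) -> I y ->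
  mean_after k.+1 H y <= mean_after k H y.
Proof.
move=> p1 Istep Hdec; elim: k y => [|k ih] y Iy.
  rewrite /= -[leRHS]mul1r -p1 mulr_suml.
  by apply: ler_sum => i _; rewrite ler_wpM2l// Hdec.
by apply: ler_sum => i _; rewrite ler_wpM2l//; apply/ih/Istep.
Qed.

(** A supermartingale drift inequality summed over time, [G] being the guaranteed expected
    decrease. *)
Lemma mean_after_telescope H G I k y : (forall y i, I y -> I (step y i)) ->
  (forall y, I y -> \sum_i p i * H (step y i) <= H y - G y) -> I y ->
  mean_after k H y + \sum_(j < k) mean_after j G y <= H y.
Proof.
move=> Istep HG; elim: k y => [|k ih] y Iy; first by rewrite big_ord0 addr0.
rewrite big_ord_recl [mean_after 0 _ _]/=.
under eq_bigr do rewrite /=.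
(* The sum over later times goes inside the average over [i], where the induction hypothesis starts
   from [step y i]. *)
rewrite exchange_big /= addrCA -big_split /=.
rewrite -lerBrDl; apply: le_trans (HG _ Iy); apply: ler_sum => i _.
by rewrite -mulr_sumr -mulrDr ler_wpM2l// ih//; exact: Istep.
Qed.

End mean_after.

(** * Law of a run driven by independent indices *)

Section random_run.
Context {R : realType} {n : nat} {X : Type}.
Context {disp : measure_display} {T : measurableType disp}.
Context {P : probability T R}.
Variables (p : 'I_n.+1 -> R) (step : X -> 'I_n.+1 -> X).
Variable idx : nat -> {RV P >-> 'I_n.+1}.
Hypothesis idx_indep : mutually_independent idx.
Hypothesis idx_distr : forall k j, P (idx k @^-1` [set j]) = (p j)%:E.

Definition history (s : seq 'I_n.+1) : set T :=
  [set w | forall k, (k < size s)%N -> idx k w = nth ord0 s k].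

(** [m] is the time of the first index consumed. Recursion on that index matches [mean_after];
    [runS] gives the form in which the iterates are defined. *)
Fixpoint run (y : X) (m k : nat) (w : T) : X :=
  if k is k'.+1 then run (step y (idx m w)) m.+1 k' w else y.

Lemma runS y m k w : run y m k.+1 w = step (run y m k w) (idx (m + k) w).
Proof.
elim: k y m => [|k ih] y m; first by rewrite /= addn0.
by rewrite [LHS]ih addSnnS.
Qed.

Lemma run_history y s w : history s w -> run y 0 (size s) w = foldl step y s.
Proof.
elim/last_ind: s => // s i ih; rewrite /history /= size_rcons => sw.
rewrite runS foldl_rcons ih; last first.
  by move=> k ks; rewrite sw ?ltnS 1?ltnW// nth_rcons ks.
by rewrite add0n sw// nth_rcons ltnn eqxx.
Qed.

Lemma history_rcons s i :
  history (rcons s i) = history s `&` idx (size s) @^-1` [set i].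
Proof.
apply/seteqP; split=> w; rewrite /history /= size_rcons.
  move=> sw; split; last by rewrite sw// nth_rcons ltnn eqxx.
  by move=> k ks; rewrite sw ?ltnS 1?ltnW// nth_rcons ks.
move=> [sw wi] k; rewrite ltnS leq_eqVlt => /predU1P[->|ks].
  by rewrite nth_rcons ltnn eqxx.
by rewrite nth_rcons ks sw.
Qed.

Lemma history_bigcap s : history s =
  \bigcap_(k in [set` iota 0 (size s)]) idx k @^-1` [set nth ord0 s k].
Proof.
apply/seteqP; split=> w /= sw k /=.
  by rewrite mem_iota add0n => /sw.
by move=> ks; apply: sw; rewrite /= mem_iota add0n.
Qed.

Lemma measurable_history s : measurable (history s).
Proof.
elim/last_ind: s => [|s i ms].
  by rewrite (_ : history _ = setT)// -subTset.
rewrite history_rcons; apply: measurableI => //.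
by rewrite -[X in measurable X]setTI; exact: measurable_funP.
Qed.

Lemma probability_history s : P (history s) = (\prod_(i <- s) p i)%:E.
Proof.
rewrite history_bigcap (idx_indep (A := fun k => [set nth ord0 s k]))//;
  last exact: iota_uniq.
rewrite (big_nth ord0) /index_iota subn0 -prodEFin.
by apply: eq_bigr => k _; rewrite idx_distr.
Qed.

Lemma history_nonempty s : (forall i, 0 < p i) -> history s !=set0.
Proof.
move=> p0; apply/set0P/eqP => s0.
have := probability_history s; rewrite s0 measure0 => -[] /eqP.
by rewrite eq_sym gt_eqF// prodr_gt0.
Qed.

(** [X] carries no sigma-algebra and [H] is arbitrary: measurability comes from splitting the
    preimage over the finitely many values of the next index. *)
Lemma measurable_run (H : X -> R) y m k :
  measurable_fun [set: T] (fun w => H (run y m k w)).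
Proof.
elim: k y m => [|k ih] y m; first exact: (measurable_cst (H y)).
move=> _ B mB; rewrite setTI.
rewrite (_ : _ @^-1` _ = \big[setU/set0]_(i : 'I_n.+1)
    (idx m @^-1` [set i] `&` (fun w => H (run (step y i) m.+1 k w)) @^-1` B)).
  apply: bigsetU_measurable => i _; apply: measurableI.
    by rewrite -[X in measurable X]setTI; exact: measurable_funP.
  by rewrite -[X in measurable X]setTI; exact: ih.
rewrite -bigcup_seq; apply/seteqP; split => w /=.
  by move=> Bw; exists (idx m w) => //=; rewrite mem_index_enum.
by move=> [i _ [<-]].
Qed.

(* Conditioning on the past as an explicit event makes independence enter only
   through [probability_history]. *)
Lemma integral_history (H : X -> R) s y k : (forall y, 0 <= H y) ->
  (\int[P]_(w in history s) (H (run y (size s) k w))%:E)%E =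
  ((\prod_(i <- s) p i) * mean_after p step k H y)%:E.
Proof.
move=> H0; elim: k s y => [|k ih] s y.
  transitivity ((H y)%:E * P (history s))%E.
    by have := integral_cst P (measurable_history s) (H y)%:E.
  by rewrite probability_history -EFinM mulrC.
(* Split the event by the next index, so that on each piece the next point of the run is known. *)
have hE : history s = \big[setU/set0]_(i <- index_enum 'I_n.+1)
    history (rcons s i).
  rewrite -bigcup_seq; apply/seteqP; split => w /=.
    move=> sw; exists (idx (size s) w); first by rewrite /= mem_index_enum.
    by rewrite history_rcons.
  by move=> [i _]; rewrite history_rcons => -[].
rewrite hE ge0_integral_bigsetU//=.
- rewrite mulr_sumr -sumEFin; apply: eq_bigr => i _.
  rewrite mulrA -big_rcons/= -ih size_rcons; apply: eq_integral => w.
  by rewrite inE history_rcons => -[_ /= ->].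
- by move=> i; exact: measurable_history.
- exact: index_enum_uniq.
- move=> i j _ _ [w]; rewrite !history_rcons => -[[_ /= <-] [_ /= <-]] //.
- apply/measurable_EFinP.
  have := measurable_run H y (size s) k.+1.
  by apply: measurable_funS => //.
- by move=> w _; rewrite lee_fin.
Qed.

Lemma integral_run (H : X -> R) y k : (forall y, 0 <= H y) ->
  (\int[P]_w (H (run y 0 k w))%:E)%E = (mean_after p step k H y)%:E.
Proof.
move=> H0; have := integral_history [::] y k H0.
by rewrite big_nil mul1r (_ : history _ = setT)// -subTset.
Qed.

End random_run.

(** * The Lyapunov function *)

Lemma sum_coord_update (R : pzRingType) n (h : 'I_n -> R -> R) (y : 'rV[R]_n)
    i (d : R) :
  \sum_j h j ((y + d *: delta_mx ord0 i) ord0 j) =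
  \sum_j h j (y ord0 j) + (h i (y ord0 i + d) - h i (y ord0 i)).
Proof.
rewrite (bigD1 i)//= [X in _ = X + _](bigD1 i)//= !mxE !eqxx mulr1.
rewrite [X in _ = X + _]addrC -addrA subrKC [LHS]addrC; congr (_ + _).
by apply: eq_bigr => j ji; rewrite !mxE (negPf ji) andbF mulr0 addr0.
Qed.

Section lyapunov.
Context {R : realType} {n : nat}.
Variables (f : 'rV[R]_n -> R) (psi_ : 'I_n -> R -> \bar R).
Variables (L Lbar p : 'I_n -> R) (pmin : R) (x0 xbar : 'rV[R]_n).
Hypothesis f_convex : convex_function [set: 'rV[R]_n] f.
Hypothesis f_diff : forall x, differentiable f x.
Hypothesis L_gt0 : forall i, 0 < L i.
Hypothesis f_smooth : forall i (x : 'rV[R]_n) (h : R),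
  `|gradient f x ord0 i - gradient f (x + h *: delta_mx ord0 i) ord0 i|
    <= L i * `|h|.
Hypothesis psi_i_convex : forall i, convex_efun (V := R^o) (psi_ i).
Hypothesis psi_i_gtNy : forall i t, (-oo < psi_ i t)%E.
Hypothesis le_L_Lbar : forall i, L i <= Lbar i.
Hypothesis p_sum : \sum_i p i = 1.
Hypothesis pmin_gt0 : 0 < pmin.
Hypothesis p_ge : forall i, pmin <= p i.
Hypothesis xbar_fin : forall i, (psi_ i (xbar ord0 i) < +oo)%E.
Hypothesis xbar_opt : forall i z, (psi_ i z < +oo)%E ->
  fine (psi_ i (xbar ord0 i)) <=
  fine (psi_ i z) + gradient f xbar ord0 i * (z - xbar ord0 i).

(* Off its domain, [psi_ i] is replaced by its supporting line at [xbar], so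
   that [gap] is real-valued and nonnegative everywhere. *)
Definition psi_fin i t : R :=
  if (psi_ i t < +oo)%E then fine (psi_ i t)
  else fine (psi_ i (xbar ord0 i)) - gradient f xbar ord0 i * (t - xbar ord0 i).

Definition gap (y : 'rV[R]_n) : R :=
  f y + \sum_i psi_fin i (y ord0 i) -
  (f xbar + \sum_i psi_fin i (xbar ord0 i)).

(** The constant is [2 / pmin] times the remainder found in [gap_prox_step_penalty]; [x0] occurs
    because a coordinate off its domain still has its initial value. *)
Definition penalty i t : R :=
  if (psi_ i t < +oo)%E then 0
  else 2 / pmin * (L i / pmin + Lbar i / 2) * (xbar ord0 i - x0 ord0 i) ^+ 2.

Definition sqdist (y : 'rV[R]_n) : R :=
  \sum_i Lbar i / p i * ((y - xbar) ord0 i) ^+ 2.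

Definition lyapunov y : R :=
  sqdist y + 2 / pmin * gap y + \sum_i penalty i (y ord0 i).

Definition prox_step (y : 'rV[R]_n) i d := argmin (fun t : R =>
  ((gradient f y ord0 i * t + Lbar i / 2 * t ^+ 2)%:E
   + psi_ i (y ord0 i + t)%R)%E) d.

(** Invariant of the run: the first update of a coordinate brings it into its domain, where it
    stays. *)
Definition finite_or_initial (y : 'rV[R]_n) i :=
  (psi_ i (y ord0 i) < +oo)%E \/ y ord0 i = x0 ord0 i.

Let Lbar_gt0 i : 0 < Lbar i. Proof. exact: lt_le_trans (le_L_Lbar i). Qed.
Let p_gt0 i : 0 < p i. Proof. exact: lt_le_trans (p_ge i). Qed.

Lemma psi_fin_xbar i : psi_fin i (xbar ord0 i) = fine (psi_ i (xbar ord0 i)).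
Proof. by rewrite /psi_fin xbar_fin. Qed.

Lemma psi_fin_support i t :
  psi_fin i (xbar ord0 i) - gradient f xbar ord0 i * (t - xbar ord0 i) <=
  psi_fin i t.
Proof.
rewrite psi_fin_xbar /psi_fin; case: ifP => // t_fin.
by rewrite lerBlDr xbar_opt.
Qed.

(** Summing the supporting lines bounds the Bregman divergence of [f] from [xbar], the quantity that
    [gradient_diff_sqr_le] requires. *)
Lemma bregman_le_gap y :
  f y - f xbar - \sum_i gradient f xbar ord0 i * (y - xbar) ord0 i <= gap y.
Proof.
rewrite /gap; set G := \sum_i _ * _.
have : \sum_i psi_fin i (xbar ord0 i) - G <= \sum_i psi_fin i (y ord0 i).
  rewrite /G -sumrB; apply: ler_sum => i _.
  rewrite (_ : (y - xbar) ord0 i = y ord0 i - xbar ord0 i);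
    last by rewrite !mxE.
  exact: psi_fin_support.
by lra.
Qed.

Lemma gap_ge0 y : 0 <= gap y.
Proof.
apply: le_trans (bregman_le_gap y).
by have := convex_gradient_le f_diff xbar y f_convex; lra.
Qed.

Lemma penalty_ge0 i t : 0 <= penalty i t.
Proof.
rewrite /penalty; case: ifP => // _.
have Li := ltW (L_gt0 i); have Lbi := ltW (Lbar_gt0 i); have pm := ltW pmin_gt0.
by rewrite mulr_ge0 ?sqr_ge0// mulr_ge0// ?addr_ge0// divr_ge0.
Qed.

Lemma sqdist_le_lyapunov y : sqdist y <= lyapunov y.
Proof.
rewrite /lyapunov -addrA lerDl addr_ge0//.
  by rewrite mulr_ge0 ?gap_ge0// divr_ge0// ltW.
by apply: sumr_ge0 => i _; exact: penalty_ge0.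
Qed.

Lemma sqdist_ge0 y : 0 <= sqdist y.
Proof.
by apply: sumr_ge0 => i _; rewrite mulr_ge0 ?sqr_ge0// divr_ge0// ltW.
Qed.

Lemma lyapunov_ge0 y : 0 <= lyapunov y.
Proof. exact: le_trans (sqdist_ge0 y) (sqdist_le_lyapunov y). Qed.

(** * Effect of one proximal step *)

Section step.
Variables (y : 'rV[R]_n) (i : 'I_n) (d : R).
Hypothesis dP : prox_step y i d.

Let y' := y + d *: delta_mx ord0 i.

Lemma prox_step_fin : (psi_ i (y' ord0 i) < +oo)%E.
Proof.
rewrite /y' !mxE !eqxx mulr1.
exact: (prox_fin (psi_i_gtNy i) dP (xbar_fin i)).
Qed.

Lemma prox_step_finite_or_initial j :
  finite_or_initial y j -> finite_or_initial y' j.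
Proof.
have [->|ji] := eqVneq j i; first by left; exact: prox_step_fin.
by rewrite /finite_or_initial /y' !mxE (negPf ji) andbF mulr0 addr0.
Qed.

Lemma prox_step_fin_mono j :
  (psi_ j (y ord0 j) < +oo)%E -> (psi_ j (y' ord0 j) < +oo)%E.
Proof.
have [->|ji] := eqVneq j i; first by move=> _; exact: prox_step_fin.
by rewrite /y' !mxE (negPf ji) andbF mulr0 addr0.
Qed.

Let psi_new : psi_fin i (y ord0 i + d) = fine (psi_ i (y ord0 i + d)).
Proof. by rewrite /psi_fin (prox_fin (psi_i_gtNy i) dP (xbar_fin i)). Qed.

Lemma gap_prox_step : gap y' - gap y <= gradient f y ord0 i * d
  + Lbar i / 2 * d ^+ 2 + psi_fin i (y ord0 i + d) - psi_fin i (y ord0 i).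
Proof.
have up := coordinate_descent f_diff d (f_smooth i y).
rewrite -/y' in up.
rewrite /gap /y' sum_coord_update -/y'.
have : L i / 2 * d ^+ 2 <= Lbar i / 2 * d ^+ 2.
  by rewrite ler_wpM2r ?sqr_ge0// ler_pM2r// invr_gt0.
by lra.
Qed.

(** Compare [d] with the null step, admissible since the coordinate is in its domain. *)
Lemma gap_prox_step_le : (psi_ i (y ord0 i) < +oo)%E -> gap y' <= gap y.
Proof.
move=> y_fin; rewrite -subr_le0; apply: le_trans gap_prox_step _.
rewrite psi_new {1}/psi_fin y_fin.
have := prox_min (psi_i_gtNy i) dP y_fin.
by rewrite subrr expr0n/=; lra.
Qed.

(** Off the domain, compare the step with the jump to the coordinate of [xbar], then absorb the
    gradient difference into the gap by Young's inequality. *)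
Lemma gap_prox_step_penalty : finite_or_initial y i ->
  2 / pmin * (gap y' - gap y) <= gap y + penalty i (y ord0 i).
Proof.
move=> yi; have c0 : 0 < 2 / pmin by rewrite divr_gt0.
case: (boolP (psi_ i (y ord0 i) < +oo)%E) => y_fin.
  apply: (@le_trans _ _ 0); last exact: addr_ge0 (gap_ge0 _) (penalty_ge0 _ _).
  by rewrite pmulr_rle0// subr_le0 gap_prox_step_le.
have y_init : y ord0 i = x0 ord0 i.
  by case: yi => [y_fin'|//]; case/negP: y_fin.
set t := xbar ord0 i - y ord0 i.
set u := gradient f y ord0 i - gradient f xbar ord0 i.
(* The slope of the supporting line turns the gradient at [y] into the difference [u]. *)
have inc : gap y' - gap y <= u * t + Lbar i / 2 * t ^+ 2.
  apply: le_trans gap_prox_step _; rewrite psi_new.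
  have := prox_min (psi_i_gtNy i) dP (xbar_fin i); rewrite -/t.
  have tE : y ord0 i - xbar ord0 i = - t by rewrite opprB.
  by rewrite /psi_fin (negPf y_fin) tE /u; lra.
have usq : u ^+ 2 <= 2 * L i * gap y.
  have := gradient_diff_sqr_le f_diff xbar (L_gt0 i) f_convex (f_smooth i y).
  move=> /le_trans; apply.
  by rewrite ler_pM2l ?bregman_le_gap// mulr_gt0.
have young : u * t <= pmin / 2 * gap y + L i / pmin * t ^+ 2.
  have := L_gt0 i => Li.
  (* u t <= (pmin / 4 L_i) u^2 + (L_i / pmin) t^2 *)
  have sq : 0 <= (pmin * u - 2 * L i * t) ^+ 2 by rewrite sqr_ge0.
  have q0 : 0 < 4 * L i * pmin by rewrite !mulr_gt0.
  have h : pmin * u ^+ 2 <= pmin * (2 * L i * gap y) by rewrite ler_pM2l.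
  rewrite -(ler_pM2l q0).
  rewrite (_ : 4 * L i * pmin * (_ + _) =
    2 * L i * pmin ^+ 2 * gap y + 4 * L i ^+ 2 * t ^+ 2); last first.
    by field; rewrite gt_eqF.
  by nra.
rewrite /penalty (negPf y_fin) -y_init -/t.
apply: (@le_trans _ _ (2 / pmin * (pmin / 2 * gap y
    + L i / pmin * t ^+ 2 + Lbar i / 2 * t ^+ 2))).
  by rewrite ler_pM2l//; lra.
rewrite le_eqVlt; apply/orP; left; apply/eqP; field.
by rewrite gt_eqF.
Qed.

(** The factor [p i] cancels the weight [1 / p i] of [sqdist], which leaves a bound that can be
    summed over [i]. *)
Lemma lyapunov_prox_step : finite_or_initial y i ->
  p i * (lyapunov y' - lyapunov y) <=
  2 * (psi_fin i (xbar ord0 i) - psi_fin i (y ord0 i)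
       + gradient f y ord0 i * (xbar ord0 i - y ord0 i)) + p i * gap y.
Proof.
move=> yi.
have pen := gap_prox_step_penalty yi.
have pen' : penalty i (y ord0 i + d) = 0.
  by rewrite /penalty (prox_fin (psi_i_gtNy i) dP (xbar_fin i)).
have three := prox_three_point (psi_i_gtNy i) dP (@psi_i_convex i) (xbar_fin i).
rewrite -psi_new -psi_fin_xbar in three.
have inc := gap_prox_step.
have sqE : sqdist y' - sqdist y =
    Lbar i / p i * (2 * d * (y ord0 i - xbar ord0 i) + d ^+ 2).
  pose h j (t : R) := Lbar j / p j * (t - xbar ord0 j) ^+ 2.
  have hE z : sqdist z = \sum_j h j (z ord0 j).
    by apply: eq_bigr => j _; rewrite /h !mxE.
  by rewrite !hE /y' sum_coord_update /h; ring.
have lE : p i * (lyapunov y' - lyapunov y) =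
    Lbar i * (2 * d * (y ord0 i - xbar ord0 i) + d ^+ 2)
    + p i * (2 / pmin * (gap y' - gap y)) - p i * penalty i (y ord0 i).
  have -> : lyapunov y' - lyapunov y = sqdist y' - sqdist y
      + 2 / pmin * (gap y' - gap y) - penalty i (y ord0 i).
    rewrite /lyapunov /y' (sum_coord_update penalty) -/y' pen'; ring.
  by rewrite sqE; field; rewrite gt_eqF//= gt_eqF.
rewrite lE.
(* Of the weight [p i], a share [pmin] yields exactly twice the change of the gap, left for the
   proximal inequality; the share [p i - pmin] is bounded by [pen]. *)
have main : p i * (2 / pmin * (gap y' - gap y)) - 2 * (gap y' - gap y)
    <= p i * gap y + p i * penalty i (y ord0 i).
  have -> : 2 * (gap y' - gap y) = pmin * (2 / pmin * (gap y' - gap y)).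
    by field; rewrite gt_eqF.
  rewrite -mulrBl -mulrDr.
  have pp : 0 <= p i - pmin by rewrite subr_ge0.
  apply: (le_trans (ler_wpM2l pp pen)).
  apply: ler_wpM2r; first exact: addr_ge0 (gap_ge0 _) (penalty_ge0 _ _).
  by rewrite gerBl ltW.
(* Adding twice [inc] and twice [three], all terms in [d] cancel. *)
lra.
Qed.

End step.

(** Summed over [i], the first part of each bound is at most [- 2 * gap y] by convexity of [f],
    while the terms [p i * gap y] add up to [gap y]. *)
Lemma lyapunov_descent (y : 'rV[R]_n) (d : 'I_n -> R) :
  (forall i, prox_step y i (d i)) -> (forall i, finite_or_initial y i) ->
  \sum_i p i * lyapunov (y + d i *: delta_mx ord0 i) <= lyapunov y - gap y.
Proof.
move=> dP yi.
have sumE : \sum_i p i * lyapunov (y + d i *: delta_mx ord0 i) = lyapunov y +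
    \sum_i p i * (lyapunov (y + d i *: delta_mx ord0 i) - lyapunov y).
  rewrite -[X in X + _]mul1r -p_sum mulr_suml -big_split/=.
  by apply: eq_bigr => i _; ring.
rewrite sumE.
rewrite lerD2l.
apply: le_trans (ler_sum _ (fun i _ => lyapunov_prox_step (dP i) (yi i))) _.
rewrite big_split/= -mulr_suml p_sum mul1r -mulr_sumr big_split/= sumrB.
have := convex_gradient_le f_diff y xbar f_convex.
have -> : \sum_i gradient f y ord0 i * (xbar ord0 i - y ord0 i) =
    \sum_i gradient f y ord0 i * (xbar - y) ord0 i.
  by apply: eq_bigr => i _; rewrite !mxE.
by rewrite /gap; lra.
Qed.

End lyapunov.

(** * Convergence *)

Section separable.
Context {R : realType} {n : nat}.
Variables (psi : 'rV[R]_n -> \bar R) (psi_ : 'I_n -> R -> \bar R).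
Hypothesis psi_sep : forall x, psi x = (\sum_i psi_ i (x ord0 i))%E.

(** In sums of extended reals [-oo] absorbs [+oo], so one summand [-oo] would make [psi] equal to
    [-oo] at a constant vector. *)
Lemma separable_gtNy : (forall x, (-oo < psi x)%E) ->
  forall i t, (-oo < psi_ i t)%E.
Proof.
move=> psiNy i t; have := psiNy (const_mx t); rewrite !ltNye psi_sep.
apply: contra => /eqP it; apply/eqP/esum_eqNyP; exists i.
by rewrite mem_index_enum mxE.
Qed.

Hypothesis psi_i_gtNy : forall i t, (-oo < psi_ i t)%E.

Lemma separable_lty (x : 'rV[R]_n) i :
  (psi x < +oo)%E -> (psi_ i (x ord0 i) < +oo)%E.
Proof.
rewrite !ltey psi_sep; apply: contra => /eqP ix; apply/eqP/esum_eqyP.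
  by move=> j _; rewrite -ltNye.
by exists i; rewrite mem_index_enum.
Qed.

Lemma separable_fin (x : 'rV[R]_n) : (forall i, psi_ i (x ord0 i) < +oo)%E ->
  psi x = (\sum_i fine (psi_ i (x ord0 i)))%:E.
Proof.
move=> x_fin; rewrite psi_sep -sumEFin; apply: eq_bigr => i _.
by rewrite fineK// fin_numElt psi_i_gtNy x_fin.
Qed.

End separable.

(** Moving only coordinate [i], minimality of [xbar] and [coordinate_descent] show that the null
    step solves the proximal problem at [xbar]; its subgradient inequality is the claim. *)
Lemma separable_minimizer_support (R : realType) n (f : 'rV[R]_n -> R)
    (psi : 'rV[R]_n -> \bar R) (psi_ : 'I_n -> R -> \bar R) (L : R)
    (xbar : 'rV[R]_n) i z :
  (forall x : 'rV[R]_n, differentiable f x) ->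
  (forall h, `|gradient f xbar ord0 i
      - gradient f (xbar + h *: delta_mx ord0 i) ord0 i| <= L * `|h|) ->
  (forall x : 'rV[R]_n, psi x = (\sum_i psi_ i (x ord0 i))%E) ->
  (forall i t, (-oo < psi_ i t)%E) -> convex_efun (V := R^o) (psi_ i) ->
  (psi xbar < +oo)%E -> argmin (fun x => ((f x)%:E + psi x)%E) xbar ->
  (psi_ i z < +oo)%E ->
  fine (psi_ i (xbar ord0 i)) <=
  fine (psi_ i z) + gradient f xbar ord0 i * (z - xbar ord0 i).
Proof.
move=> f_diff f_smooth psi_sep psiNy cpsi xbar_fin xbar_min z_fin.
have xi_fin j := separable_lty psi_sep psiNy j xbar_fin.
suff min0 : argmin (fun t => ((gradient f xbar ord0 i * t + L / 2 * t ^+ 2)%:E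
    + psi_ i (xbar ord0 i + t)%R)%E) 0.
  have := prox_three_point (psiNy i) min0 cpsi z_fin.
  by rewrite mulr0 !addr0.
move=> t; rewrite mulr0 expr0n/= mulr0 !addr0 add0e.
have [t_fin|] := boolP (psi_ i (xbar ord0 i + t)%R < +oo)%E; last first.
  by rewrite -leNgt leye_eq => /eqP ->; rewrite addey ?leey.
have := xbar_min (xbar + t *: delta_mx ord0 i).
rewrite /= !(separable_fin psi_sep psiNy)//; last first.
  move=> j; have [->|ji] := eqVneq j i; first by rewrite !mxE !eqxx mulr1.
  by rewrite !mxE (negPf ji) andbF mulr0 addr0.
rewrite (sum_coord_update (fun j s => fine (psi_ j s))) -!EFinD lee_fin.
move=> min_t.
rewrite -[psi_ i (xbar ord0 i)]fineK ?fin_numElt ?psiNy ?xi_fin//.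
rewrite -[psi_ i (xbar ord0 i + t)%R]fineK ?fin_numElt ?psiNy//.
rewrite -EFinD lee_fin.
have := coordinate_descent f_diff t f_smooth.
by lra.
Qed.

Theorem theorem6 (R : realType) (n : nat)
  (f : 'rV[R]_n.+1 -> R) (L : 'I_n.+1 -> R)
  (f_convex : convex_function [set: 'rV[R]_n.+1] f)
  (f_diff : forall x : 'rV[R]_n.+1, differentiable f x)
  (L_gt0 : forall i, 0 < L i)
  (f_smooth : forall (i : 'I_n.+1) (x : 'rV[R]_n.+1) (h : R),
    `|gradient f x ord0 i - gradient f (x + h *: delta_mx ord0 i) ord0 i|
      <= L i * `|h|)
  (psi : 'rV[R]_n.+1 -> \bar R) (psi_ : 'I_n.+1 -> R -> \bar R)
  (psi_convex : convex_efun psi) (psi_proper : proper_efun psi)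
  (psi_closed : closed_efun psi)
  (psi_i_convex : forall i, convex_efun (V := R^o) (psi_ i))
  (psi_sep : forall x : 'rV[R]_n.+1, psi x = (\sum_i psi_ i (x ord0 i))%E)
  (F : 'rV[R]_n.+1 -> \bar R) (FE : forall x, F x = ((f x)%:E + psi x)%E)
  (Omega_neq0 : argmin F !=set0)
  (Fstar : \bar R) (FstarE : Fstar = ereal_inf (range F))
  (Lbar : 'I_n.+1 -> R) (le_L_Lbar : forall i, L i <= Lbar i)
  (p : 'I_n.+1 -> R) (pmin : R) (p_sum : \sum_i p i = 1) (pmin_gt0 : 0 < pmin)
  (p_ge : forall i, pmin <= p i)
  (disp : measure_display) (T : measurableType disp) (P : probability T R)
  (idx : nat -> {RV P >-> 'I_n.+1})
  (idx_indep : mutually_independent idx)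
  (idx_distr : forall k j, P (idx k @^-1` [set j]) = (p j)%:E)
  (x0 : 'rV[R]_n.+1) (x : nat -> T -> 'rV[R]_n.+1) (d : nat -> T -> R)
  (x_init : forall w, x 0%N w = x0)
  (d_argmin : forall k w,
    argmin (fun t : R =>
              ((gradient f (x k w) ord0 (idx k w) * t
                + Lbar (idx k w) / 2 * t ^+ 2)%:E
               + psi_ (idx k w) (x k w ord0 (idx k w) + t)%R)%E) (d k w))
  (x_step : forall k w,
    x k.+1 w = x k w + d k w *: delta_mx ord0 (idx k w)) :
  ((F x0 < +oo)%E ->
   (k%:R%:E * (\int[P]_w F (x k w) - Fstar))%E @[k --> \oo] --> 0%E)
  /\
  (forall xbar : 'rV[R]_n.+1, argmin F xbar ->
   exists M : R, forall k : nat,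
    ('E_P[fun w => (\sum_i Lbar i / p i * ((x k w - xbar) ord0 i) ^+ 2)%R]
       <= M%:E)%E).
Proof.
have [[x1 x1_fin] psi_gtNy] := psi_proper.
have psiNy := separable_gtNy psi_sep psi_gtNy.
have FE' : F = (fun x => ((f x)%:E + psi x)%E) by apply/funext.
have FEfin y : (F y < +oo)%E -> (psi y < +oo)%E.
  by rewrite FE; case: (psi y) => //= r _; rewrite ltry.
have min_fin xbar : argmin F xbar -> (psi xbar < +oo)%E.
  move=> /(_ x1) le_x1; apply: FEfin; apply: le_lt_trans le_x1 _.
  by rewrite FE lte_add_pinfty ?ltry.
have xi_fin xbar (xm : argmin F xbar) i :=
  separable_lty psi_sep psiNy i (min_fin xbar xm).
have xi_opt xbar (xm : argmin F xbar) i z :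
    (psi_ i z < +oo)%E -> fine (psi_ i (xbar ord0 i)) <=
    fine (psi_ i z) + gradient f xbar ord0 i * (z - xbar ord0 i).
  apply: (separable_minimizer_support f_diff (f_smooth i xbar) psi_sep) => //.
  - exact: min_fin.
  - by rewrite -FE'.
(* The default 0 is taken only where no minimizer exists; [dE] and [dminP] exclude this at the
   points met. *)
pose dmin (y : 'rV[R]_n.+1) i := xget 0 (prox_step f psi_ Lbar y i).
pose step (y : 'rV[R]_n.+1) i := y + dmin y i *: delta_mx ord0 i.
have [xs xsm] := Omega_neq0.
have p_gt0 i : 0 < p i by exact: lt_le_trans (p_ge i).
have p_ge0 i : 0 <= p i by exact: ltW.
have Lbar_gt0 i : 0 < Lbar i by exact: lt_le_trans (le_L_Lbar i).
have dE k w : dmin (x k w) (idx k w) = d k w.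
  apply: xget_unique; first exact: d_argmin.
  move=> t tP; apply: (prox_unique (psiNy (idx k w)) (@psi_i_convex (idx k w))
    (xi_fin _ xsm (idx k w)) (Lbar_gt0 (idx k w)) tP).
  exact: d_argmin.
(* Proximal steps being unique, the iterates are functions of the indices. *)
have xE k w : x k w = run step idx x0 0 k w.
  elim: k => [|k ih]; first by rewrite x_init.
  by rewrite runS -ih x_step add0n /step dE.
pose reachable y := exists s, y = foldl step x0 s.
have reachable_step y i : reachable y -> reachable (step y i).
  by move=> [s ->]; exists (rcons s i); rewrite foldl_rcons.
(* Every finite index sequence has positive probability, so [d_argmin] yields
   a minimizer at every reachable point, for every coordinate. *)
have dminP y i : reachable y -> prox_step f psi_ Lbar y i (dmin y i).
  move=> [s ->].
  have [w] := history_nonempty idx_indep idx_distr (rcons s i) p_gt0.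
  rewrite history_rcons => -[sw /= wi].
  suff dP : prox_step f psi_ Lbar (foldl step x0 s) i (d (size s) w).
    exact: xgetI dP.
  by rewrite -(run_history step x0 sw) -xE -wi; exact: d_argmin.
pose inv y := reachable y /\ forall i, finite_or_initial psi_ x0 y i.
have inv_step y i : inv y -> inv (step y i).
  move=> [yr yi]; split; first exact: reachable_step.
  move=> j; apply: (prox_step_finite_or_initial psiNy (xi_fin _ xsm)) => //.
  exact: dminP.
have inv0 : inv x0 by split=> [|i]; [exists [::]|right].
have descent xbar (xm : argmin F xbar) y : inv y ->
    \sum_i p i * lyapunov f psi_ L Lbar p pmin x0 xbar (step y i) <=
    lyapunov f psi_ L Lbar p pmin x0 xbar y - gap f psi_ xbar y.
  move=> [yr yi]; apply: lyapunov_descent => //.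
  - exact: xi_fin.
  - exact: xi_opt.
  - by move=> i; exact: dminP.
have gap0 xbar (xm : argmin F xbar) y : 0 <= gap f psi_ xbar y.
  by apply: gap_ge0 => //; [exact: xi_fin|exact: xi_opt].
have sum_bound xbar (xm : argmin F xbar) k :
    mean_after p step k (lyapunov f psi_ L Lbar p pmin x0 xbar) x0 +
    \sum_(j < k) mean_after p step j (gap f psi_ xbar) x0 <=
    lyapunov f psi_ L Lbar p pmin x0 xbar x0.
  by apply: (mean_after_telescope p_ge0 k inv_step) => //; exact: descent.
split; last first.
  (* The initial Lyapunov value is finite even when [F x0] is not, thanks to [psi_fin]. *)
  move=> xbar xm; exists (lyapunov f psi_ L Lbar p pmin x0 xbar x0) => k.
  rewrite unlock.
  under eq_integral do rewrite xE.
  have sq0 y : 0 <= sqdist Lbar p xbar y.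
    exact: (sqdist_ge0 xbar L_gt0 le_L_Lbar pmin_gt0 p_ge y).
  have := integral_run step idx_indep idx_distr x0 k sq0.
  rewrite /sqdist => ->; rewrite lee_fin.
  apply: le_trans (sum_bound _ xm k).
  rewrite -[leLHS]addr0 lerD//.
    apply: (mean_after_le p_ge0 k inv_step) => // y _.
    by apply: (sqdist_le_lyapunov p x0 f_convex) => //;
      [exact: xi_fin|exact: xi_opt].
  apply: sumr_ge0 => j _; apply: (mean_after_ge0 p_ge0 j inv_step) => // y _.
  exact: gap0.
move=> x0_fin.
have x0i_fin i := separable_lty psi_sep psiNy i (FEfin _ x0_fin).
(* A stronger invariant, available when [F x0] is finite: the gap then decreases at every step,
   whichever index is drawn. *)
pose dom y := reachable y /\ forall i, (psi_ i (y ord0 i) < +oo)%E.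
have dom_step y i : dom y -> dom (step y i).
  move=> [yr yi]; split; first exact: reachable_step.
  move=> j; apply: (prox_step_fin_mono psiNy (xi_fin _ xsm)) => //.
  exact: dminP.
have dom0 : dom x0 by split=> //; exists [::].
have domx k w : dom (x k w).
  by rewrite xE; elim: k => // k ih; rewrite runS; exact: dom_step.
pose u k := mean_after p step k (gap f psi_ xs) x0.
have u0 k : 0 <= u k.
  apply: (mean_after_ge0 p_ge0 k inv_step) => // y _; exact: gap0.
have uS k : u k.+1 <= u k.
  apply: (mean_after_noninc p_ge0 k p_sum dom_step) => // y i [yr yi].
  exact: (gap_prox_step_le f_diff f_smooth psiNy le_L_Lbar (xi_fin _ xsm)
    (dminP _ _ yr)).
have uM k : \sum_(j < k) u j <= lyapunov f psi_ L Lbar p pmin x0 xs x0.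
  apply: le_trans (sum_bound _ xsm k); rewrite lerDr.
  apply: (mean_after_ge0 p_ge0 k inv_step) => // y _.
  by apply: (lyapunov_ge0 x0 f_convex) => //; [exact: xi_fin|exact: xi_opt].
pose c := f xs + \sum_i psi_fin f psi_ xs i (xs ord0 i).
have psi_finE (y : 'rV[R]_n.+1) : (forall i, (psi_ i (y ord0 i) < +oo)%E) ->
    F y = (f y + \sum_i psi_fin f psi_ xs i (y ord0 i))%:E.
  move=> y_fin; rewrite FE (separable_fin psi_sep psiNy)// -EFinD.
  by congr (_ + _)%:E; apply: eq_bigr => i _; rewrite /psi_fin y_fin.
have FstarE' : Fstar = c%:E.
  rewrite FstarE -psi_finE; last exact: xi_fin.
  apply/eqP; rewrite eq_le; apply/andP; split.
    by apply: ereal_inf_lbound; exists xs.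
  by apply: le_ereal_inf_tmp => _ [y _ <-]; exact: xsm.
(* [F] may be negative, whereas [integral_run] asks for a nonnegative function: it is applied to the
   gap, and the constant is integrated apart. *)
have FxE k w :
    F (x k w) = ((gap f psi_ xs (run step idx x0 0 k w))%:E + c%:E)%E.
  rewrite psi_finE; last exact: (domx k w).2.
  by rewrite -EFinD -xE /gap subrK.
have intF k : (\int[P]_w F (x k w))%E = (u k + c)%:E.
  under eq_integral do rewrite FxE.
  have g0 y := gap0 _ xsm y.
  have intg := integral_run step idx_indep idx_distr x0 k g0.
  rewrite integralD//=.
  - by rewrite intg integral_cst//= probability_setT mule1.
  - apply/integrableP; split.
      apply/measurable_EFinP.
      exact: (measurable_run step idx (gap f psi_ xs) x0 0 k).
    under eq_integral do rewrite gee0_abs ?lee_fin//.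
    by rewrite intg ltry.
  - exact: finite_measure_integrable_cst.
have uE k : (k%:R%:E * (\int[P]_w F (x k w) - Fstar))%E = (k%:R * u k)%:E.
  by rewrite intF FstarE' -EFinB -EFinM addrK.
under eq_fun do rewrite uE.
apply: cvg_EFin; first by near=> k.
exact: (nonincreasing_summable_o u0 uS uM).
Unshelve. all: by end_near.
Qed.
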